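(* All algebras in $\mathcal{ECC}_{00}\cup\mathcal{ECC}_{10}\cup\mathcal{ECC}_{01}\cup\mathcal{ECC}_{11}$ are endo-commutative and curled. Conversely, an arbitrary endo-commutative curled algebra of dimension $2$ over $\mathbb F_2$ is isomorphic to one of the algebras in $\mathcal{ECC}_{00}\cup\mathcal{ECC}_{10}\cup\mathcal{ECC}_{01}\cup\mathcal{ECC}_{11}$.
   Context: An algebra over the two-element field $\mathbb F_2$ is an $\mathbb F_2$-vector space with a bilinear multiplication, not assumed associative, commutative or unital. An algebra $A$ is endo-commutative if $x^2y^2=(xy)^2$ for all $x,y\in A$. A two-dimensional algebra is curled if, for every element $x$, the square $x^2$ is a scalar multiple of $x$. For $a,b,c,d,\varepsilon,\delta\in\mathbb F_2$, $C(a,b,c,d;\varepsilon,\delta)$ denotes the two-dimensional algebra over $\mathbb F_2$ with linear base $\{e,f\}$ and $e^2=\varepsilon e$, $f^2=\delta f$, $ef=ae+bf$, $fe=ce+df$. Put $C_0=C(0,0,0,0;0,0)$, $C_1=C(0,1,0,1;0,0)$, $C_{1'}=C(1,0,1,0;0,0)$, $C_{1''}=C(1,1,1,1;0,0)$, $C_2=C(0,1,1,0;0,0)$, $C_3=C(1,0,0,1;0,0)$, $C_4=C(0,1,0,0;1,0)$, $C_5=C(1,1,0,1;1,0)$, $C_6=C(0,1,1,1;1,0)$, $C_7=C(0,0,0,1;1,0)$, $C_8=C(1,1,1,0;0,1)$, $C_9=C(1,0,1,1;0,1)$, $C_{10}=C(0,0,1,0;0,1)$, $C_{11}=C(1,0,0,0;0,1)$,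 $C_{12}=C(0,0,0,0;1,1)$, $C_{12'}=C(0,1,0,1;1,1)$, $C_{12''}=C(1,0,1,0;1,1)$, $C_{13}=C(1,1,1,1;1,1)$, $C_{14}=C(0,1,1,0;1,1)$, $C_{15}=C(1,0,0,1;1,1)$, and $\mathcal{ECC}_{00}=\{C_0,C_1,C_{1'},C_{1''},C_2,C_3\}$, $\mathcal{ECC}_{10}=\{C_4,C_5,C_6,C_7\}$, $\mathcal{ECC}_{01}=\{C_8,C_9,C_{10},C_{11}\}$, $\mathcal{ECC}_{11}=\{C_{12},C_{12'},C_{12''},C_{13},C_{14},C_{15}\}$. *)

(* Defs.v *)
From HB Require Import structures.
From mathcomp Require Import all_boot all_order all_algebra.
From mathcomp Require Import ring.

Set Implicit Arguments.
Unset Strict Implicit.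
Unset Printing Implicit Defensive.

Import GRing.Theory.
Local Open Scope ring_scope.

(* An F_2-algebra is a vector space V over 'F_2 together with a multiplication
   m : {bilinear V -> V -> V}; no associativity, commutativity or unit. *)

Definition endo_commutative (V : lmodType 'F_2) (m : {bilinear V -> V -> V}) :
    Prop :=
  forall x y : V, m (m x x) (m y y) = m (m x y) (m x y).

Definition curled (V : lmodType 'F_2) (m : {bilinear V -> V -> V}) : Prop :=
  forall x : V, exists k : 'F_2, m x x = k *: x.

Definition isomorphic (V W : lmodType 'F_2) (m : {bilinear V -> V -> V})
    (n : {bilinear W -> W -> W}) : Prop :=
  exists phi : {linear V -> W},
    bijective phi /\ forall x y : V, phi (m x y) = n (phi x) (phi y).

Definition base_e : 'rV['F_2]_2 := delta_mx 0 0.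
Definition base_f : 'rV['F_2]_2 := delta_mx 0 1.

(* The bilinear extension to 'rV['F_2]_2 of the table
   e^2 = eps e, f^2 = del f, ef = a e + b f, fe = c e + d f. *)
Definition Cmul (a b c d eps del : 'F_2) (x y : 'rV['F_2]_2) : 'rV['F_2]_2 :=
  (x 0 0 * y 0 0) *: (eps *: base_e) +
  (x 0 0 * y 0 1) *: (a *: base_e + b *: base_f) +
  (x 0 1 * y 0 0) *: (c *: base_e + d *: base_f) +
  (x 0 1 * y 0 1) *: (del *: base_f).

Fact Cmul_bilinear (a b c d eps del : 'F_2) :
  bilinear_for *:%R *:%R (Cmul a b c d eps del).
Proof.
by split=> u k v w; apply/rowP=> i; rewrite /Cmul !mxE; ring.
Qed.

HB.instance Definition _ (a b c d eps del : 'F_2) :=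
  bilinear_isBilinear.Build 'F_2 'rV['F_2]_2 'rV['F_2]_2 'rV['F_2]_2
    *:%R *:%R (Cmul a b c d eps del) (Cmul_bilinear a b c d eps del).

Notation alg2 := {bilinear 'rV['F_2]_2 -> 'rV['F_2]_2 -> 'rV['F_2]_2}.

Definition C (a b c d eps del : 'F_2) : alg2 := Cmul a b c d eps del.

Fact C_table (a b c d eps del : 'F_2) :
  [/\ C a b c d eps del base_e base_e = eps *: base_e,
      C a b c d eps del base_f base_f = del *: base_f,
      C a b c d eps del base_e base_f = a *: base_e + b *: base_f
    & C a b c d eps del base_f base_e = c *: base_e + d *: base_f].
Proof.
by split; rewrite /C /= /Cmul /base_e /base_f !mxE /= !(mulr0, mul0r, mulr1)
  !(scale0r, scale1r) ?(addr0, add0r).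
Qed.

Definition C_0 := C 0 0 0 0 0 0.
Definition C_1 := C 0 1 0 1 0 0.
Definition C_1' := C 1 0 1 0 0 0.
Definition C_1'' := C 1 1 1 1 0 0.
Definition C_2 := C 0 1 1 0 0 0.
Definition C_3 := C 1 0 0 1 0 0.
Definition C_4 := C 0 1 0 0 1 0.
Definition C_5 := C 1 1 0 1 1 0.
Definition C_6 := C 0 1 1 1 1 0.
Definition C_7 := C 0 0 0 1 1 0.
Definition C_8 := C 1 1 1 0 0 1.
Definition C_9 := C 1 0 1 1 0 1.
Definition C_10 := C 0 0 1 0 0 1.
Definition C_11 := C 1 0 0 0 0 1.
Definition C_12 := C 0 0 0 0 1 1.
Definition C_12' := C 0 1 0 1 1 1.
Definition C_12'' := C 1 0 1 0 1 1.
Definition C_13 := C 1 1 1 1 1 1.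
Definition C_14 := C 0 1 1 0 1 1.
Definition C_15 := C 1 0 0 1 1 1.

(* Lists stand for finite sets, read through List.In, because alg2 has no
   decidable equality. *)
Definition ECC_00 : seq alg2 := [:: C_0; C_1; C_1'; C_1''; C_2; C_3].
Definition ECC_10 : seq alg2 := [:: C_4; C_5; C_6; C_7].
Definition ECC_01 : seq alg2 := [:: C_8; C_9; C_10; C_11].
Definition ECC_11 : seq alg2 := [:: C_12; C_12'; C_12''; C_13; C_14; C_15].

Definition ECC : seq alg2 := ECC_00 ++ ECC_10 ++ ECC_01 ++ ECC_11.

(* Main.v *)
Require Import Defs.
From mathcomp Require Import all_boot all_order all_algebra.
From mathcomp Require Import ring.
Local Open Scope ring_scope.

Set Implicit Arguments.
Unset Strict Implicit.
Unset Printing Implicit Defensive.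
Import GRing.Theory passmx.

(** The classification needs no isomorphism beyond the choice of a basis.  In a
curled algebra every basis u, v satisfies u^2 = eps u and v^2 = del v, so
coordinates in it identify the algebra with some C(a,b,c,d;eps,del)
([curled_isomorphic_C]).  Endo-commutativity and curledness are invariant under
isomorphism, so this C has both properties.  Over F_2 there are only 64
sextuples (a,b,c,d,eps,del), and the plane has only four vectors, so both
properties of C are decidable by multiplying coordinate pairs
([admissibleP]).  Running this test on all sextuples accepts exactly the twenty
of the list ([admissible_ECC_tables]): the listed algebras are therefore
endo-commutative and curled, and the C found above is equal, not merely
isomorphic, to a listed one. *)

(** * Invariance under isomorphism *)

Lemma isomorphic_endo_commutative (V W : lmodType 'F_2)
    (m : {bilinear V -> V -> V}) (n : {bilinear W -> W -> W}) :
  isomorphic m n -> endo_commutative m -> endo_commutative n.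
Proof.
move=> [phi [[psi _ psiK] phiM]] ecm x y.
by rewrite -(psiK x) -(psiK y) -!phiM ecm.
Qed.

Lemma isomorphic_curled (V W : lmodType 'F_2)
    (m : {bilinear V -> V -> V}) (n : {bilinear W -> W -> W}) :
  isomorphic m n -> curled m -> curled n.
Proof.
move=> [phi [[psi _ psiK] phiM]] cm x; have [k mk] := cm (psi x).
by exists k; rewrite -(psiK x) -phiM mk linearZ.
Qed.

(** * Reduction to a multiplication table *)

Lemma bilinear_comb2 (R : comNzRingType) (V : lmodType R)
    (m : {bilinear V -> V -> V}) (u v : V) (k l r s : R) :
  m (k *: u + l *: v) (r *: u + s *: v) =
  (k * r) *: m u u + (k * s) *: m u v + (l * r) *: m v u + (l * s) *: m v v.
Proof.
by rewrite linearDl !linearDr !linearZl_LR !linearZr_LR /= !scalerA !addrA.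
Qed.

Lemma row2_comb (w : 'rV['F_2]_2) : w = w 0 0 *: base_e + w 0 1 *: base_f.
Proof.
rewrite [LHS]row_sum_delta big_ord_recl big_ord1.
by rewrite (_ : lift ord0 ord0 = 1) //; apply: val_inj.
Qed.

Lemma dim_coord (F : fieldType) (V : vectType F) (n : nat) :
  \dim {:V} = n -> exists phi : {linear V -> 'rV[F]_n}, bijective phi.
Proof.
move=> <-; exists (rVof (vbasis {:V})), (vecof (vbasis {:V})).
  by apply: rVofK; apply: vbasisP.
by apply: vecofK; apply: vbasisP.
Qed.

(** Any basis serves: curledness of its two members gives their squares the
shape that the table requires, and the table puts no constraint on the two
mixed products, whose coordinates are a, b, c, d. *)
Lemma curled_isomorphic_C (V : vectType 'F_2) (m : {bilinear V -> V -> V}) :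
  \dim {:V} = 2%N -> curled m ->
  exists a b c d eps del, isomorphic m (C a b c d eps del).
Proof.
move=> /dim_coord[phi [psi phiK psiK]] cm.
pose u := psi base_e; pose v := psi base_f.
have [[eps uu] [del vv]] := (cm u, cm v).
exists (phi (m u v) 0 0), (phi (m u v) 0 1).
exists (phi (m v u) 0 0), (phi (m v u) 0 1), eps, del, phi.
split; first by exists psi.
have phi_comb x : x = phi x 0 0 *: u + phi x 0 1 *: v.
  by apply: (can_inj phiK); rewrite linearD !linearZ /= !psiK -row2_comb.
move=> x y; rewrite {1}[x]phi_comb {1}[y]phi_comb bilinear_comb2 uu vv.
by rewrite !linearD !linearZ /= !psiK /Cmul -!row2_comb.
Qed.

(** * The finite decision *)

(** Explicit enumerations replace the generic ones of the finite types, which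
are opaque and would block evaluation. *)
Definition F2_elements : seq 'F_2 := [:: 0; 1].

Lemma mem_F2_elements (k : 'F_2) : k \in F2_elements.
Proof. by case: k => [[|[|]]]. Qed.

Definition plane : seq ('F_2 * 'F_2) :=
  [seq (k, l) | k <- F2_elements, l <- F2_elements].

Lemma mem_plane (p : 'F_2 * 'F_2) : p \in plane.
Proof. by case: p => k l; apply: allpairs_f; apply: mem_F2_elements. Qed.

Definition table : Type := 'F_2 * 'F_2 * 'F_2 * 'F_2 * 'F_2 * 'F_2.

Definition tables : seq table :=
  [seq (p, q.1, q.2) | p <- [seq (p, q.1, q.2) | p <- plane, q <- plane],
                       q <- plane].

Lemma mem_tables (t : table) : t \in tables.
Proof.
case: t => [[[[[a b] c] d] eps] del].
apply: (allpairs_f (fun p q => (p, q.1, q.2)) _ (mem_plane (eps, del))).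
exact: (allpairs_f (fun p q => (p, q.1, q.2)) (mem_plane _) (mem_plane (c, d))).
Qed.

Definition table_algebra (t : table) : alg2 :=
  let: (a, b, c, d, eps, del) := t in C a b c d eps del.

(** The product on pairs instead of row vectors, since matrices do not
evaluate. *)
Definition table_mul (t : table) (p q : 'F_2 * 'F_2) : 'F_2 * 'F_2 :=
  let: (a, b, c, d, eps, del) := t in
  (p.1 * q.1 * eps + p.1 * q.2 * a + p.2 * q.1 * c,
   p.1 * q.2 * b + p.2 * q.1 * d + p.2 * q.2 * del).

Definition coords (w : 'rV['F_2]_2) : 'F_2 * 'F_2 := (w 0 0, w 0 1).
Definition row_of_coords (p : 'F_2 * 'F_2) : 'rV['F_2]_2 :=
  p.1 *: base_e + p.2 *: base_f.

Lemma coordsK : cancel coords row_of_coords.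
Proof. by move=> w; rewrite [RHS]row2_comb. Qed.

Lemma row_of_coordsK : cancel row_of_coords coords.
Proof.
move=> [k l]; rewrite /coords /row_of_coords /base_e /base_f !mxE /=.
by rewrite !mulr1 !mulr0 addr0 add0r.
Qed.

Lemma coords_mul (t : table) (x y : 'rV['F_2]_2) :
  coords (table_algebra t x y) = table_mul t (coords x) (coords y).
Proof.
case: t => [[[[[a b] c] d] eps] del].
rewrite /coords /table_algebra /C /= /Cmul /base_e /base_f !mxE /=.
by congr pair; ring.
Qed.

(** Over F_2 the only multiples of p are 0 and p, so curledness is membership of
the square in a list of two pairs. *)
Definition admissible (t : table) : bool :=
  all (fun p => (table_mul t p p \in [:: (0, 0); p]) &&
    all (fun q => table_mul t (table_mul t p p) (table_mul t q q)
      == table_mul t (table_mul t p q) (table_mul t p q)) plane) plane.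

Lemma admissibleP (t : table) :
  reflect (endo_commutative (table_algebra t) /\ curled (table_algebra t))
    (admissible t).
Proof.
have coords_inj := can_inj coordsK.
apply: (iffP allP) => [adm | [ecA cA] p _].
  have {adm} adm x := andP (adm (coords x) (mem_plane _)).
  split=> [x y | x].
    have [_ /allP/(_ _ (mem_plane (coords y)))/eqP] := adm x.
    by rewrite -!coords_mul => /coords_inj.
  have [] := adm x; rewrite -coords_mul !inE => /orP[] /eqP sq_x _.
    by exists 0; apply: coords_inj; rewrite sq_x /coords scale0r !mxE.
  by exists 1; apply: coords_inj; rewrite sq_x scale1r.
rewrite -[p]row_of_coordsK; set x := row_of_coords p; apply/andP; split.
  rewrite -coords_mul; have [k ->] := cA x; rewrite !inE.
  have := mem_F2_elements k; rewrite !inE => /orP[] /eqP ->.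
    by rewrite scale0r /coords !mxE.
  by rewrite scale1r eqxx orbT.
apply/allP=> q _; rewrite -[q]row_of_coordsK.
by rewrite -!coords_mul ecA.
Qed.

Definition ECC_tables : seq table :=
  [:: (0, 0, 0, 0, 0, 0); (0, 1, 0, 1, 0, 0); (1, 0, 1, 0, 0, 0);
      (1, 1, 1, 1, 0, 0); (0, 1, 1, 0, 0, 0); (1, 0, 0, 1, 0, 0);
      (0, 1, 0, 0, 1, 0); (1, 1, 0, 1, 1, 0); (0, 1, 1, 1, 1, 0);
      (0, 0, 0, 1, 1, 0); (1, 1, 1, 0, 0, 1); (1, 0, 1, 1, 0, 1);
      (0, 0, 1, 0, 0, 1); (1, 0, 0, 0, 0, 1); (0, 0, 0, 0, 1, 1);
      (0, 1, 0, 1, 1, 1); (1, 0, 1, 0, 1, 1); (1, 1, 1, 1, 1, 1);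
      (0, 1, 1, 0, 1, 1); (1, 0, 0, 1, 1, 1)].

(** The twenty sextuples are all the solutions, not representatives up to
isomorphism; this is why no explicit isomorphism between two tables occurs. *)
Lemma admissible_ECC_tables (t : table) : admissible t = (t \in ECC_tables).
Proof.
have/allP: all (fun t => admissible t == (t \in ECC_tables)) tables.
  by vm_compute.
by move/(_ t (mem_tables t))/eqP.
Qed.

(** Bilinear maps carry no boolean equality while sextuples do, so membership in
the list is transferred to the tables. *)
Lemma In_ECC (A : alg2) :
  List.In A ECC <-> exists2 t, t \in ECC_tables & A = table_algebra t.
Proof.
have -> : ECC = map table_algebra ECC_tables by [].
elim: ECC_tables => [|t ts [to_table of_table]] /=; first by split=> [|[]].
split=> [[<- | Ats] | [s /predU1P[-> -> | ts_s As]]].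
- by exists t; rewrite ?mem_head.
- by have [s ts_s ->] := to_table Ats; exists s; rewrite // inE ts_s orbT.
- by left.
- by right; apply: of_table; exists s.
Qed.

Theorem proposition3 :
  (forall A : alg2, List.In A ECC -> endo_commutative A /\ curled A) /\
  (forall (V : vectType 'F_2) (m : {bilinear V -> V -> V}),
     \dim {:V} = 2%N -> endo_commutative m -> curled m ->
     exists2 A : alg2, List.In A ECC & isomorphic m A).
Proof.
split=> [A /In_ECC[t ECCt ->] | V m dimV ecm cm].
  by apply/admissibleP; rewrite admissible_ECC_tables.
have [a [b [c [d [eps [del isoC]]]]]] := curled_isomorphic_C dimV cm.
exists (C a b c d eps del) => //; apply/In_ECC.
exists (a, b, c, d, eps, del) => //; rewrite -admissible_ECC_tables.
apply/admissibleP; split.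
  exact: isomorphic_endo_commutative isoC ecm.
exact: isomorphic_curled isoC cm.
Qed.
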